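(* There is a polynomial-time reduction from 3SAT to EPMX: a polynomial-time computable map sending each 3-CNF Boolean formula $\varphi$ to an EPMX instance $f(\varphi)$ such that $\varphi$ is satisfiable if and only if player $X$ has a winning strategy in $f(\varphi)$ (with $X$ moving first).
   Context: Multistate variables: a variable $x_a$ has a finite set of possible states $s_1,\dots,s_k$; the literal $x_{a,s_i}$ is true iff $x_a$ is assigned state $s_i$. An XOR clause $(\ell_1\oplus\cdots\oplus\ell_q)$ of such literals is true iff an odd number of its literals are true (a literal may appear more than once in a clause). A Multistate XOR-SAT position is a conjunction of such clauses whose variables are partitioned between two players $X$ and $Y$ (clauses may mix both players' variables). Players alternate turns; on a turn the current player picks one of their own unassigned variables and assigns it a state. After all variables are assigned, $X$ wins if the formula is true and $Y$ wins otherwise. EPMX (Equal-Partitioned Multistate XOR-SAT) is the case where $X$ and $Y$ own the same number of variables. 3SAT is the problem of deciding satisfiability of a Boolean CNF formula with at most three literals per clause. *)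

(* Defs.v *)
From HB Require Import structures.
From mathcomp Require Import all_boot.

Set Implicit Arguments.
Unset Strict Implicit.
Unset Printing Implicit Defensive.

(** * Boolean formulas in conjunctive normal form *)

(* The variables are x_0, ..., x_(cnf_nvars - 1); the literal (b, v) is true
   iff x_v has the value b. *)
Record cnf := Cnf {
  cnf_nvars : nat;
  cnf_clauses : seq (seq (bool * nat)) }.

Definition is_3cnf (phi : cnf) : bool :=
  all (fun c => (size c <= 3) && all (fun l => l.2 < cnf_nvars phi) c)
      (cnf_clauses phi).

Definition cnf3 := {phi : cnf | is_3cnf phi}.

Definition cnf_true (rho : nat -> bool) (phi : cnf) : bool :=
  all (has (fun l => rho l.2 == l.1)) (cnf_clauses phi).

Definition satisfiable (phi : cnf) : Prop := exists rho, cnf_true rho phi.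

(** * Multistate XOR-SAT positions *)

Inductive player := PlayerX | PlayerY.

Definition is_PlayerX (q : player) := if q is PlayerX then true else false.
Definition player_of_bool (b : bool) := if b then PlayerX else PlayerY.
Lemma is_PlayerXK : cancel is_PlayerX player_of_bool. Proof. by case. Qed.
HB.instance Definition _ := Equality.copy player (can_type is_PlayerXK).

(* The a-th entry (q, k) of [vars] declares a variable x_a owned by q, with
   states 0, ..., k - 1; the pair (a, s) stands for the literal x_{a,s}, and
   also for the move that assigns state s to x_a. *)
Record position := Position {
  vars : seq (player * nat);
  xor_clauses : seq (seq (nat * nat)) }.

Definition nvars (p : position) : nat := size (vars p).
Definition owner (p : position) (a : nat) : player :=
  (nth (PlayerX, 0) (vars p) a).1.
Definition nstates (p : position) (a : nat) : nat :=
  (nth (PlayerX, 0) (vars p) a).2.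

Definition well_formed (p : position) : bool :=
  all (fun v => 0 < v.2) (vars p) &&
  all (fun c => (c != [::]) &&
         all (fun l => (l.1 < nvars p) && (l.2 < nstates p l.1)) c)
      (xor_clauses p).

Definition owned_by (q : player) (p : position) : nat :=
  count (fun v => v.1 == q) (vars p).

Definition is_epmx (p : position) : bool :=
  well_formed p && (owned_by PlayerX p == owned_by PlayerY p).

Definition epmx := {p : position | is_epmx p}.

(** * The game *)

(* The sequence of moves made so far, oldest first. *)
Definition history := seq (nat * nat).

Definition turn (h : history) : player :=
  if odd (size h) then PlayerY else PlayerX.

Definition complete (p : position) (h : history) : bool := size h == nvars p.

Definition legal_move (p : position) (h : history) (m : nat * nat) : bool :=
  [&& m.1 < nvars p, m.1 \notin unzip1 h, owner p m.1 == turn h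
    & m.2 < nstates p m.1].

Definition legal_play (p : position) (h : history) : Prop :=
  forall i, i < size h -> legal_move p (take i h) (nth (0, 0) h i).

(* A literal (a, s) is true under the assignment made by h iff the move (a, s)
   occurs in h; [count] takes repeated literals into account. *)
Definition xor_clause_true (h : history) (c : seq (nat * nat)) : bool :=
  odd (count (fun l => l \in h) c).

Definition formula_true (p : position) (h : history) : bool :=
  all (xor_clause_true h) (xor_clauses p).

Definition strategy := history -> nat * nat.

Definition X_follows (sigma : strategy) (h : history) : Prop :=
  forall i, i < size h -> turn (take i h) = PlayerX ->
    nth (0, 0) h i = sigma (take i h).

(* When both players own equally many variables, the player to move in an
   incomplete legal play always has an unassigned variable, so that the first
   condition never fails for lack of a legal move. *)
Definition X_winning_strategy (p : position) (sigma : strategy) : Prop :=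
  forall h, legal_play p h -> X_follows sigma h ->
    (~~ complete p h -> turn h = PlayerX -> legal_move p h (sigma h)) /\
    (complete p h -> formula_true p h).

Definition X_has_winning_strategy (p : position) : Prop :=
  exists sigma, X_winning_strategy p sigma.

(** * Encoding of instances as words *)

Inductive symbol :=
  | Zero | One | Open | Close | Pos | Neg | Var | VarX | VarY | State | At.

Definition symbols :=
  [:: Zero; One; Open; Close; Pos; Neg; Var; VarX; VarY; State; At].
Definition symbol_index (s : symbol) : nat :=
  match s with
  | Zero => 0 | One => 1 | Open => 2 | Close => 3 | Pos => 4 | Neg => 5
  | Var => 6 | VarX => 7 | VarY => 8 | State => 9 | At => 10
  end.
Lemma symbol_indexK : pcancel symbol_index (onth symbols).
Proof. by case. Qed.
HB.instance Definition _ := Countable.copy symbol (pcan_type symbol_indexK).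
Lemma symbols_enumP : Finite.axiom symbols. Proof. by case. Qed.
HB.instance Definition _ := isFinite.Build symbol symbols_enumP.

(* Binary numerals, least significant bit first; 0 is the empty word. *)
Fixpoint positive_code (n : BinNums.positive) : seq symbol :=
  match n with
  | BinNums.xH => [:: One]
  | BinNums.xO n' => Zero :: positive_code n'
  | BinNums.xI n' => One :: positive_code n'
  end.

Definition nat_code (n : nat) : seq symbol :=
  if bin_of_nat n is BinNums.Npos n' then positive_code n' else [::].

Definition clause_code (L : Type) (lit_code : L -> seq symbol) (c : seq L) :=
  Open :: rcons (flatten (map lit_code c)) Close.

(* The variables of an instance, and the states of a multistate variable, are
   listed one by one; clauses refer to them by their index in binary. *)
Definition cnf_code (phi : cnf) : seq symbol :=
  nseq (cnf_nvars phi) Var ++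
  flatten (map (clause_code (fun l : bool * nat =>
                  (if l.1 then Pos else Neg) :: nat_code l.2))
               (cnf_clauses phi)).

Definition position_code (p : position) : seq symbol :=
  flatten (map (fun v : player * nat =>
                  (if v.1 is PlayerX then VarX else VarY) :: nseq v.2 State)
               (vars p)) ++
  flatten (map (clause_code (fun l : nat * nat =>
                  Var :: nat_code l.1 ++ At :: nat_code l.2))
               (xor_clauses p)).

(** * Deterministic multitape Turing machines *)

Inductive direction := GoLeft | Stay | GoRight.

(* A tape cell contains an instance symbol, an auxiliary symbol, or the blank
   [None]. *)
Definition cell (G : finType) : finType := option (symbol + G)%type.

(* The machine has [extra_tapes + 1] tapes: the input is written on tape
   [ord0], the output is read on tape [ord_max]. *)
Record machine := Machine {
  extra_tapes : nat;
  aux_symbol : finType;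
  state : finType;
  start : state;
  final : pred state;
  transition : state -> {ffun 'I_extra_tapes.+1 -> cell aux_symbol} ->
    state * {ffun 'I_extra_tapes.+1 -> cell aux_symbol * direction} }.

Section Tapes.
Variable G : finType.

(* A two-way infinite tape: the cells to the left of the head, nearest first,
   then the scanned cell and those to its right; unlisted cells are blank. *)
Definition tape := (seq (cell G) * seq (cell G))%type.

Definition read (t : tape) : cell G := head None t.2.

Definition write_move (t : tape) (x : cell G * direction) : tape :=
  let: (l, r) := (t.1, x.1 :: behead t.2) in
  match x.2 with
  | GoLeft => (behead l, head None l :: r)
  | Stay => (l, r)
  | GoRight => (head None r :: l, behead r)
  end.

Definition word_cells (w : seq symbol) : seq (cell G) :=
  [seq Some (inl s) | s <- w].

Definition tape_holds (t : tape) (w : seq symbol) : Prop :=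
  exists i j,
    rev t.1 ++ t.2 = nseq i None ++ word_cells w ++ nseq j None.

End Tapes.

Section Runs.
Variable M : machine.

Definition config :=
  (state M * {ffun 'I_(extra_tapes M).+1 -> tape (aux_symbol M)})%type.

Definition initial (w : seq symbol) : config :=
  (start M, [ffun i => if i == ord0 then ([::], word_cells _ w)
                       else ([::], [::])]).

Definition step (C : config) : config :=
  if final C.1 then C
  else let: (q, act) := transition C.1 [ffun i => read (C.2 i)] in
       (q, [ffun i => write_move (C.2 i) (act i)]).

Definition outputs_within (T : nat) (w w' : seq symbol) : Prop :=
  let C := iter T step (initial w) in
  final C.1 /\ tape_holds (C.2 ord_max) w'.

End Runs.

Definition polytime_computable (A B : Type) (codeA : A -> seq symbol)
    (codeB : B -> seq symbol) (f : A -> B) : Prop :=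
  exists (M : machine) (c d : nat), forall x : A,
    outputs_within M (c * size (codeA x) ^ d + c) (codeA x) (codeB (f x)).

(* Main.v *)
(** Player Y can be given variables that occur in no clause: then X wins iff some
    assignment of X's own variables satisfies the formula. Each clause of the 3-CNF
    formula gets one further X-variable, whose seven states are the ways in which
    its three literals can be true or false without all being false; for each literal
    one XOR clause forces that state to agree with the literal. So the multistate
    variables provide the disjunctions that XOR clauses cannot express.

    The Turing machine keeps in its state a bounded stack of instructions. It reads
    the input from left to right to declare the variables of X, from right to left
    to declare those of Y, and once more from left to right to write the XOR clauses,
    with the index of the current gadget variable as a binary counter on its second
    tape. *)

Require Import Defs.
From HB Require Import structures.
From mathcomp Require Import all_boot.
From mathcomp Require Import zify.

Set Implicit Arguments.
Unset Strict Implicit.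
Unset Printing Implicit Defensive.

(** * The reduction *)

Definition valuation_true (g : nat -> nat) (c : seq (nat * nat)) : bool :=
  odd (count (fun l => l.2 == g l.1) c).

(** * The game when the variables of Y occur in no clause *)

Section PassiveOpponent.

Variables (p : position) (N : nat).
Hypothesis nvarsE : nvars p = N + N.
Hypothesis ownerE :
  forall a, a < N + N -> owner p a = if a < N then PlayerX else PlayerY.
Hypothesis nstates_gt0 : forall a, a < N + N -> 0 < nstates p a.
Hypothesis clauses_X :
  forall c, c \in xor_clauses p -> forall l, l \in c -> l.1 < N.

Lemma formula_true_valuation g (h : history) :
    (forall a s, a < N -> ((a, s) \in h) = (s == g a)) ->
  formula_true p h = all (valuation_true g) (xor_clauses p).
Proof.
move=> hg; apply: eq_in_all => c c_p.
congr odd; apply: eq_in_count => -[a s] l_c /=.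
exact/hg/(clauses_X c_p l_c).
Qed.

Lemma legal_play_rcons h m :
  legal_play p (rcons h m) <-> legal_play p h /\ legal_move p h m.
Proof.
split=> [lp | [lp lm] i].
  split=> [i ih|].
    have := lp i; rewrite size_rcons ltnS (ltnW ih) nth_rcons ih -cats1.
    by rewrite takel_cat ?(ltnW ih) //; apply.
  have := lp (size h); rewrite size_rcons ltnSn nth_rcons ltnn eqxx -cats1.
  by rewrite take_size_cat //; apply.
rewrite size_rcons ltnS leq_eqVlt => /orP[/eqP-> | ih].
  by rewrite nth_rcons ltnn eqxx -cats1 take_size_cat.
by rewrite nth_rcons ih -cats1 takel_cat ?(ltnW ih) //; apply: lp.
Qed.

Lemma X_follows_rcons sigma h m :
    X_follows sigma h -> (turn h = PlayerX -> m = sigma h) ->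
  X_follows sigma (rcons h m).
Proof.
move=> fo hm i; rewrite size_rcons ltnS leq_eqVlt => /orP[/eqP-> | ih].
  by rewrite nth_rcons ltnn eqxx -cats1 take_size_cat.
by rewrite nth_rcons ih -cats1 takel_cat ?(ltnW ih) //; apply: fo.
Qed.

Lemma legal_play_uniq h : legal_play p h -> uniq (unzip1 h).
Proof.
elim/last_ind: h => // h m IH /legal_play_rcons[/IH uh /and4P[_ m_h _ _]].
by rewrite /unzip1 map_rcons rcons_uniq m_h.
Qed.

(** Pigeonhole: the moves of a legal play concern distinct variables. *)
Lemma legal_play_complete h a :
  legal_play p h -> complete p h -> a < nvars p -> a \in unzip1 h.
Proof.
move=> lp /eqP sz a_lt.
have sub : {subset unzip1 h <= iota 0 (nvars p)}.
  move=> b /(nthP 0)[i]; rewrite size_map => ih <-.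
  by rewrite (nth_map (0, 0)) // mem_iota; case/and4P: (lp i ih).
have [|_ ->] := uniq_min_size (legal_play_uniq lp) sub.
  by rewrite size_iota size_map sz.
by rewrite mem_iota.
Qed.

Lemma legal_play_mem h a s :
    legal_play p h -> (a, s) \in h ->
  exists i, [/\ i < size h, nth (0, 0) h i = (a, s),
                owner p a = turn (take i h) & s < nstates p a].
Proof.
move=> lp /(nthP (0, 0))[i ih e]; exists i; split=> //;
  by have := lp i ih; rewrite e => /and4P[_ _ /eqP].
Qed.

Lemma turn_take (h : history) i : i < size h ->
  turn (take i h) = if odd i then PlayerY else PlayerX.
Proof. by move=> ih; rewrite /turn size_takel ?(ltnW ih). Qed.

(** A winning strategy is run against one fixed opponent, and the completed play yields [g].
    Conversely, X sets its variables in order according to [g], whatever Y does. *)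
Lemma passive_opponent :
  X_has_winning_strategy p <->
  exists2 g, forall a, a < N -> g a < nstates p a
           & all (valuation_true g) (xor_clauses p).
Proof.
split=> [[sigma win] | [g g_lt g_true]].
(* Y takes [N], [N + 1], ... in order with state 0, which exists by [nstates_gt0]. *)
- pose next (h : history) :=
    if odd (size h) then (N + (size h)./2, 0) else sigma h.
  pose play k := iter k (fun h => rcons h (next h)) [::].
  have size_play k : size (play k) = k.
    by elim: k => //= k IH; rewrite size_rcons IH.
  have odd_play k i : i < k -> odd i -> nth (0, 0) (play k) i = (N + i./2, 0).
    elim: k => //= k IH; rewrite ltnS leq_eqVlt nth_rcons size_play.
    case/orP=> [/eqP-> | ik] oi; last by rewrite ik IH.
    by rewrite ltnn eqxx /next size_play oi.
  have [lp fo] : legal_play p (play (N + N)) /\ X_follows sigma (play (N + N)).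
    suff: forall k, k <= N + N -> legal_play p (play k) /\ X_follows sigma (play k).
      exact.
    elim=> [|k IH] kN; first by split.
    have [lp fo] := IH (ltnW kN).
    have [mv _] := win _ lp fo.
    have incomplete : ~~ complete p (play k).
      by rewrite /complete size_play nvarsE; lia.
    rewrite /play iterS -/(play k) /=; split; last first.
      by apply: X_follows_rcons => //; rewrite /turn /next; case: odd.
    apply/legal_play_rcons; split=> //.
    have := mv incomplete; rewrite /turn /next size_play.
    case: (boolP (odd k)) => ok; last exact.
    move=> _; apply/and4P; split=> /=; first by rewrite nvarsE; lia.
    (* A variable of Y is set at an odd time [i < k] only, and is then [N + i./2], which differs
       from [N + k./2] as [k] is odd too. *)
    + apply/negP => /mapP[[b s] b_h /= bE].
      have [i [ih e]] := legal_play_mem lp b_h.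
      rewrite size_play in ih.
      rewrite turn_take ?size_play // -bE ownerE; last by lia.
      case: (boolP (odd i)) => oi; last by have ->: (N + k./2 < N) = false by lia.
      by move: e; rewrite odd_play // => -[]; lia.
    + by rewrite ownerE ?/turn ?size_play ?ok; [have ->: (N + k./2 < N) = false by lia | lia].
    + by apply: nstates_gt0; lia.
  have comp : complete p (play (N + N)) by rewrite /complete size_play nvarsE.
  have := win _ lp fo => -[_ /(_ comp)].
  set h := play _ in lp fo comp *.
  pose g a := (nth (0, 0) h (index a (unzip1 h))).2.
  have g_in a : a < N -> (a, g a) \in h.
    move=> aN; have a_h : a \in unzip1 h.
      by apply: legal_play_complete => //; rewrite nvarsE; lia.
    have ih : index a (unzip1 h) < size h by rewrite -(size_map fst) index_mem.
    have e : (nth (0, 0) h (index a (unzip1 h))).1 = a.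
      by rewrite -(nth_map _ 0) // nth_index.
    by rewrite -{1}e -surjective_pairing mem_nth.
  have g_uniq a s : (a, s) \in h -> s = g a.
    case/(nthP (0, 0)) => i ih e.
    suff iE : index a (unzip1 h) = i by rewrite /g iE e.
    have <- : nth 0 (unzip1 h) i = a by rewrite (nth_map (0, 0)) // e.
    by rewrite index_uniq ?size_map // legal_play_uniq.
  have gE a s : a < N -> ((a, s) \in h) = (s == g a).
    by move=> aN; apply/idP/eqP => [/g_uniq | ->] //; apply: g_in.
  rewrite (formula_true_valuation gE) => g_true; exists g => // a aN.
  by have [i []] := legal_play_mem lp (g_in a aN).
(* X moves at even times, so half the length of the play is the next variable to set. *)
- exists (fun h => ((size h)./2, g (size h)./2)) => h lp fo.
  have XE i : i < size h -> ~~ odd i -> nth (0, 0) h i = (i./2, g i./2).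
    move=> ih oi; rewrite fo ?turn_take ?(negPf oi) //.
    by rewrite size_takel ?(ltnW ih).
  have memX a s : a < N -> (a, s) \in h -> s = g a /\ a.*2 < size h.
    move=> aN /(legal_play_mem lp)[i [ih e]].
    rewrite ownerE ?aN ?turn_take; [|by []|by lia].
    case: (boolP (odd i)) => // oi _ _.
    by move: e; rewrite XE // => -[<- <-]; split=> //; lia.
  split=> [incomplete | /eqP comp].
    rewrite /turn; case: (boolP (odd _)) => // oh _.
    have le_h : size h <= N + N.
      rewrite -nvarsE -(size_map fst) -(size_iota 0 (nvars p)).
      apply: uniq_leq_size; first exact: legal_play_uniq.
      move=> b /(nthP 0)[i]; rewrite size_map => ih <-.
      by rewrite (nth_map (0, 0)) // mem_iota; case/and4P: (lp i ih).
    have hN : (size h)./2 < N.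
      by move: incomplete; rewrite /complete nvarsE; lia.
    apply/and4P; split=> /=; first by rewrite nvarsE; lia.
    (* Variable [b] is set at time [b.*2]; for [b = (size h)./2] this is the present time. *)
    + apply/negP => /mapP[[b s] b_h /= bE].
      by have := memX b s; rewrite -bE => /(_ hN); rewrite bE => /(_ b_h) []; lia.
    + by rewrite ownerE ?hN /turn ?(negPf oh) //; lia.
    + exact: g_lt.
  rewrite (@formula_true_valuation g) // => a s aN.
  apply/idP/eqP => [/(memX _ _ aN)[] // | ->].
  have ah : a.*2 < size h by rewrite comp nvarsE; lia.
  have := XE _ ah; rewrite odd_double doubleK => <- //.
  exact: mem_nth.
Qed.

End PassiveOpponent.

(** * The gadget of a clause *)

Definition true_literal (l : bool * nat) : nat * nat := (l.2, l.1 : nat).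

Definition holds_under (g : nat -> nat) (l : bool * nat) : bool :=
  (l.1 : nat) == g l.2.

(** For [S] without repetitions, odd parity means that exactly one holds: the first literal of [c]
    is true, or [N] is in a state of [S]. An exhausted [c] gives no literal, by [take 1 c]. *)
Definition gadget_clause (N : nat) (c : seq (bool * nat)) (S : seq nat) :=
  map true_literal (take 1 c) ++ [seq (N, s) | s <- S].

(* State [s < 7] of the gadget variable [N] records which literals are false:
   the i-th one is false iff the i-th bit of [s] is set; 7, all literals false,
   is not a state. A missing literal counts as false. *)
Definition falsifying (i : nat) : seq nat :=
  [seq s <- iota 0 7 | odd (s %/ 2 ^ i)].

Definition gadget (N : nat) (c : seq (bool * nat)) :=
  [seq gadget_clause N (drop i c) (falsifying i) | i <- iota 0 3].

Fixpoint gadgets (N : nat) (cs : seq (seq (bool * nat))) :=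
  if cs is c :: cs' then gadget N c ++ gadgets N.+1 cs' else [::].

Lemma gadgets_cons N c cs : gadgets N (c :: cs) = gadget N c ++ gadgets N.+1 cs.
Proof. by []. Qed.

(** Y gets as many variables as X, each with one state, so that Y chooses nothing but an order. *)
Definition reduction (phi : cnf) : position :=
  let n := cnf_nvars phi in let m := size (cnf_clauses phi) in
  Position (nseq n (PlayerX, 2) ++ nseq m (PlayerX, 7) ++ nseq (n + m) (PlayerY, 1))
           (gadgets n (cnf_clauses phi)).

Lemma gadgets_all (a : pred (seq (nat * nat))) N cs :
  all a (gadgets N cs) <->
  forall j, j < size cs -> all a (gadget (N + j) (nth [::] cs j)).
Proof.
elim: cs N => [|c cs IH] N; first by [].
rewrite gadgets_cons all_cat.
split=> [/andP[ac /IH acs] [|j] jl | h]; first by rewrite addn0.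
  by rewrite addnS -addSn; apply: acs.
apply/andP; split; first by rewrite -[N]addn0; apply: h 0 _.
by apply/IH => j jl; rewrite addSn -addnS; apply: h j.+1 _.
Qed.

Lemma gadget_clause_true g N c S : uniq S ->
  valuation_true g (gadget_clause N c S) =
  has (holds_under g) (take 1 c) (+) (g N \in S).
Proof.
move=> uS; rewrite /valuation_true count_cat oddD count_map; congr addb.
  by case: c => //= l c; rewrite take0 /= orbF addn0 oddb.
by rewrite count_map -[RHS]oddb -(count_uniq_mem _ uS).
Qed.

Lemma gadgetP g N c : g N < 7 ->
  all (valuation_true g) (gadget N c) =
  all (fun i => has (holds_under g) (take 1 (drop i c)) ==
                ~~ odd (g N %/ 2 ^ i)) (iota 0 3).
Proof.
move=> gN; rewrite /gadget all_map; apply: eq_all => i /=.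
rewrite gadget_clause_true ?filter_uniq ?iota_uniq // mem_filter mem_iota gN andbT.
by case: has; case: odd.
Qed.

(** If all literals were false, the clauses would set all three bits of [g N], which no number below
    7 has. *)
Lemma gadget_sound g N c : size c <= 3 -> g N < 7 ->
  all (valuation_true g) (gadget N c) -> has (holds_under g) c.
Proof.
move=> sc gN; rewrite gadgetP //.
case: (g N) gN => [|[|[|[|[|[|[|//]]]]]]] _;
  case: c sc => [|a [|b [|d [|//]]]] _; rewrite /= ?take0 /= ?orbF //;
  case: (holds_under g a) => //=; try (case: (holds_under g b) => //=);
  by case: (holds_under g d).
Qed.

(** The bits forced by the gadget clauses; for at most three literals the value is 7 exactly when
    all are false. *)
Definition falsified (g : nat -> nat) (c : seq (bool * nat)) : nat :=
  \sum_(i < 3) ~~ has (holds_under g) (take 1 (drop i c)) * 2 ^ i.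

Lemma falsified_lt g c : size c <= 3 ->
  has (holds_under g) c -> falsified g c < 7.
Proof.
rewrite /falsified !big_ord_recr big_ord0 /=.
case: c => [|a [|b [|d [|//]]]] _ //=; rewrite ?take0 /= ?orbF;
  case: (holds_under g a) => //=; try (case: (holds_under g b) => //=);
  by case: (holds_under g d).
Qed.

Lemma gadget_complete g N c : size c <= 3 ->
  has (holds_under g) c -> g N = falsified g c ->
  all (valuation_true g) (gadget N c).
Proof.
move=> sc hc gN; rewrite gadgetP // gN; last exact: falsified_lt.
rewrite /falsified !big_ord_recr big_ord0 /=.
by do 3?case: has.
Qed.

(** * Correctness of the reduction *)

Lemma reduction_nvars phi :
  nvars (reduction phi) = cnf_nvars phi + size (cnf_clauses phi) +
                          (cnf_nvars phi + size (cnf_clauses phi)).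
Proof. by rewrite /nvars !size_cat !size_nseq addnA. Qed.

Lemma reduction_vars phi a : a < nvars (reduction phi) ->
  nth (PlayerX, 0) (vars (reduction phi)) a =
    if a < cnf_nvars phi then (PlayerX, 2) else
    if a < cnf_nvars phi + size (cnf_clauses phi) then (PlayerX, 7)
    else (PlayerY, 1).
Proof.
rewrite reduction_nvars !nth_cat !size_nseq !nth_nseq => aN.
by do ![case: ifP => ? //]; lia.
Qed.

(** Serves both well-formedness and the requirement of [passive_opponent] that clauses mention
    variables of X only. *)
Lemma gadget_clause_range phi j i l :
    is_3cnf phi -> j < size (cnf_clauses phi) ->
    l \in gadget_clause (cnf_nvars phi + j) (drop i (nth [::] (cnf_clauses phi) j))
                        (falsifying i) ->
  l.1 < cnf_nvars phi + size (cnf_clauses phi) /\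
  l.2 < nstates (reduction phi) l.1.
Proof.
move=> phi3 jm; set c := nth _ _ _.
have /andP[_ /allP c_lt] := allP phi3 c (mem_nth _ jm).
rewrite mem_cat /nstates => /orP[/mapP[k k_c ->] | /mapP[s s_S ->]] /=.
  have kn : k.2 < cnf_nvars phi by apply: c_lt; apply: (mem_drop (mem_take k_c)).
  have kN : k.2 < cnf_nvars phi + size (cnf_clauses phi).
    exact: leq_trans kn (leq_addr _ _).
  rewrite reduction_vars ?reduction_nvars ?kn; last exact: leq_trans kN (leq_addr _ _).
  by case: k.1.
move: s_S; rewrite mem_filter mem_iota => /andP[_ /= s7].
rewrite reduction_vars ?reduction_nvars; last by lia.
have ->: (cnf_nvars phi + j < cnf_nvars phi) = false by lia.
have nj : cnf_nvars phi + j < cnf_nvars phi + size (cnf_clauses phi) by lia.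
by rewrite nj.
Qed.

Lemma reduction_clause_mem phi d : d \in xor_clauses (reduction phi) ->
  exists j i, [/\ j < size (cnf_clauses phi), i < 3 &
    d = gadget_clause (cnf_nvars phi + j)
          (drop i (nth [::] (cnf_clauses phi) j)) (falsifying i)].
Proof.
rewrite /reduction /=; elim: (cnf_clauses phi) (cnf_nvars phi) => // c cs IH n.
rewrite gadgets_cons mem_cat => /orP[].
  case/mapP=> i; rewrite mem_iota => i3 ->; exists 0, i.
  by rewrite addn0; split.
by case/IH=> j [i [jl i3 ->]]; exists j.+1, i; rewrite addnS -addSn.
Qed.

Lemma reduction_epmx phi : is_3cnf phi -> is_epmx (reduction phi).
Proof.
move=> phi3; rewrite /is_epmx /well_formed; apply/andP; split; last first.
  by rewrite /owned_by !count_cat !count_nseq /=; apply/eqP; lia.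
apply/andP; split; first by rewrite !all_cat !all_nseq /= !orbT.
apply/allP => d /reduction_clause_mem[j [i [jm i3 ->]]].
apply/andP; split.
  (* [falsifying i] is never empty, even if no literal is left. *)
  by case: i i3 => [|[|[|//]]] _; rewrite /gadget_clause; case: (take _ _).
apply/allP => l /(gadget_clause_range phi3 jm)[l_lt ->]; rewrite andbT.
by rewrite reduction_nvars; exact: leq_trans l_lt (leq_addr _ _).
Qed.

Lemma reduction_correct phi : is_3cnf phi ->
  satisfiable phi <-> X_has_winning_strategy (reduction phi).
Proof.
move=> phi3; set n := cnf_nvars phi; set m := size (cnf_clauses phi).
have owE a : a < n + m + (n + m) ->
    owner (reduction phi) a = if a < n + m then PlayerX else PlayerY.
  move=> aN; rewrite /owner reduction_vars ?reduction_nvars // -/n -/m.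
  by do ![case: ifP => ? //]; lia.
have nsE a : a < n + m + (n + m) -> nstates (reduction phi) a =
    if a < n then 2 else if a < n + m then 7 else 1.
  move=> aN; rewrite /nstates reduction_vars ?reduction_nvars // -/n -/m.
  by do ![case: ifP => ? //].
have ns0 a : a < n + m + (n + m) -> 0 < nstates (reduction phi) a.
  by move=> aN; rewrite nsE //; do ![case: ifP].
have clX d : d \in xor_clauses (reduction phi) -> forall l, l \in d -> l.1 < n + m.
  by case/reduction_clause_mem=> j [i [jm i3 ->]] l /(gadget_clause_range phi3 jm)[].
(* By [passive_opponent], with [N := n + m], only assignments remain to be compared. *)
apply: (iff_trans _ (iff_sym (passive_opponent (reduction_nvars phi) owE ns0 clX))).
have clP j : j < m -> let c := nth [::] (cnf_clauses phi) j in
    c \in cnf_clauses phi /\ size c <= 3.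
  by move=> jm; split; [exact: mem_nth | case/andP: (allP phi3 _ (mem_nth [::] jm))].
have litE (rho : nat -> bool) (g : nat -> nat) c :
    (forall v, v < n -> g v = rho v) -> c \in cnf_clauses phi ->
  has (fun l : bool * nat => rho l.2 == l.1) c =
  has (holds_under g) c.
  move=> gE /(allP phi3)/andP[_ /allP c_lt].
  apply: eq_in_has => -[b v] /c_lt /= vn.
  by rewrite /holds_under /= gE //; case: b; case: (rho v).
split=> [[rho /allP rho_true] | [g g_lt g_true]].
(* A gadget variable takes the state forced by the literals of its clause, computed from [rho]
   because [g] is still being defined. *)
- pose g a := if a < n then rho a : nat
              else falsified (fun v => rho v) (nth [::] (cnf_clauses phi) (a - n)).
  have gE v : v < n -> g v = rho v by rewrite /g => ->.
  have falsifiedE c : c \in cnf_clauses phi ->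
      falsified (fun v => rho v) c = falsified g c.
    move=> /(allP phi3)/andP[_ /allP c_lt]; apply: eq_bigr => i _.
    congr (~~ _ * _); apply: eq_in_has => -[b v].
    by move=> /mem_take/mem_drop/c_lt /= vn; rewrite /holds_under gE.
  have gj j : j < m -> g (n + j) = falsified g (nth [::] (cnf_clauses phi) j).
    move=> jm; have [cP _] := clP j jm.
    by rewrite /g ltnNge leq_addr /= addKn falsifiedE.
  exists g => [a aN|].
    rewrite nsE; last by lia.
    case: ifP => an; first by rewrite gE //; case: (rho a).
    rewrite aN; have jm : a - n < m by lia.
    have [cP c3] := clP _ jm.
    rewrite -[a](subnKC (_ : n <= a)); last by lia.
    rewrite gj //; apply: falsified_lt => //.
    by rewrite -(litE rho) ?rho_true.
  apply/gadgets_all => j jm.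
  have [cP c3] := clP j jm.
  by apply: gadget_complete; rewrite ?gj // -(litE rho) ?rho_true.
- exists (fun v => g v == 1); apply/allP => c cP.
  (* A Boolean variable has two states, so [g v] is 0 or 1. *)
  have gE v : v < n -> g v = (g v == 1).
    by move=> vn; have := g_lt v; rewrite nsE ?vn; [case: (g v) => [|[|k]] // /(_ _)|]; lia.
  have /= -> := litE (fun v => g v == 1) g c gE cP.
  have jm : index c (cnf_clauses phi) < m by rewrite index_mem.
  move/gadgets_all: g_true => /(_ _ jm); rewrite nth_index //.
  apply: gadget_sound; first by case/andP: (allP phi3 _ cP).
  have := g_lt (n + index c (cnf_clauses phi)).
  by rewrite nsE; [have ->: (n + index c (cnf_clauses phi) < n) = false by lia|];
     rewrite ?ltn_add2l ?jm; [apply|]; lia.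
Qed.

(** * The machine *)

Inductive command :=
  | DeclareX | DeclareY | Main | Skip | Literal | Bits | Copy | Rewind | Incr.

Definition commands :=
  [:: DeclareX; DeclareY; Main; Skip; Literal; Bits; Copy; Rewind; Incr].
Definition command_index (o : command) : nat :=
  match o with
  | DeclareX => 0 | DeclareY => 1 | Main => 2 | Skip => 3 | Literal => 4
  | Bits => 5 | Copy => 6 | Rewind => 7 | Incr => 8
  end.
Lemma command_indexK : pcancel command_index (onth commands).
Proof. by case. Qed.
HB.instance Definition _ := Countable.copy command (pcan_type command_indexK).
Lemma commands_enumP : Finite.axiom commands. Proof. by case. Qed.
HB.instance Definition _ := isFinite.Build command commands_enumP.

(* [inl s] writes [s] on the output tape. *)
Definition instr : finType := (symbol + command)%type.

Definition emit (w : seq symbol) : seq instr := map inl w.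
Definition cmd (o : command) : instr := inr o.

(** The index of the gadget variable is unbounded, so it is copied from the counter tape; the state
    is below 7 and is written by fixed instructions. *)
Definition states_code (S : seq nat) : seq instr :=
  flatten [seq inl Var :: cmd Copy :: cmd Rewind :: emit (At :: nat_code s) | s <- S].

Definition gadget_code (S : seq nat) : seq instr :=
  inl Open :: cmd Literal :: states_code S ++ [:: inl Close].

(** Each gadget code consumes at most one literal; [Skip] then passes [Close]. *)
Definition clause_program : seq instr :=
  flatten [seq gadget_code (falsifying i) | i <- iota 0 3] ++
  map cmd [:: Skip; Incr; Rewind; Main].

Notation cellv := (cell void).
Notation tapev := (tape void).
Notation sym s := (Some (inl s) : cellv).

(* The instructions replacing the executed one, the move on the input tape, the
   symbol to write and the move on the counter tape, the output. *)
Record action := Action {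
  act_next : seq instr;
  act_input : direction;
  act_counter : cellv * direction;
  act_output : option symbol }.

(** A loop is a command that puts itself back on the stack until the scanned symbol stops it.
    [DeclareX] stops on the right blank and steps back, so that [DeclareY] starts on the last
    symbol; [DeclareY] returns likewise to the first one. A negative literal writes nothing after
    [At], because 0 has the empty numeral. *)
Definition exec (o : instr) (x c : cellv) : action :=
  let go next d := Action next d (c, Stay) None in
  match o with
  | inl s => Action [::] Stay (c, Stay) (Some s)
  | inr DeclareX =>
      match x with
      | Some (inl Var) => go (emit [:: VarX; State; State] ++ [:: o]) GoRight
      | Some (inl Open) => go (emit (VarX :: nseq 7 State) ++ [:: o]) GoRight
      | Some _ => go [:: o] GoRight
      | None => go [::] GoLeft
      end
  | inr DeclareY =>
      match x with
      | Some (inl Var) | Some (inl Open) =>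
          go (emit [:: VarY; State] ++ [:: o]) GoLeft
      | Some _ => go [:: o] GoLeft
      | None => go [::] GoRight
      end
  | inr Main =>
      match x with
      | Some (inl Var) => go (map cmd [:: Incr; Rewind; Main]) GoRight
      | Some (inl Open) => go clause_program GoRight
      | _ => go [::] Stay
      end
  | inr Skip => go [::] GoRight
  | inr Literal =>
      match x with
      | Some (inl Pos) => go (inl Var :: cmd Bits :: emit [:: At; One]) GoRight
      | Some (inl Neg) => go (inl Var :: cmd Bits :: emit [:: At]) GoRight
      | _ => go [::] Stay
      end
  | inr Bits =>
      match x with
      | Some (inl Zero) => Action [:: o] GoRight (c, Stay) (Some Zero)
      | Some (inl One) => Action [:: o] GoRight (c, Stay) (Some One)
      | _ => go [::] Stay
      end
  | inr Copy =>
      match c with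
      | Some (inl s) => Action [:: o] Stay (c, GoRight) (Some s)
      | _ => Action [::] Stay (c, GoLeft) None
      end
  | inr Rewind =>
      match c with
      | Some _ => Action [:: o] Stay (c, GoLeft) None
      | None => Action [::] Stay (c, GoRight) None
      end
  | inr Incr =>
      match c with
      | Some (inl One) => Action [:: o] Stay (sym Zero, GoRight) None
      | _ => Action [::] Stay (sym One, GoLeft) None
      end
  end.

(** [clause_program] has 71 instructions, and expanding [Literal] adds three. *)
Definition stack_bound := 80.
Definition stack : finType := {bseq stack_bound of instr}.

Definition reduction_transition (q : stack) (r : {ffun 'I_3 -> cellv}) :
    stack * {ffun 'I_3 -> cellv * direction} :=
  if val q is o :: rest then
    let a := exec o (r ord0) (r (inord 1)) in
    (insub_bseq _ (act_next a ++ rest),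
     [ffun i : 'I_3 =>
        if i == ord0 then (r i, act_input a) else
        if i == ord_max then
          if act_output a is Some s then (sym s, GoRight) else (r i, Stay)
        else act_counter a])
  else (q, [ffun i => (r i, Stay)]).

Definition reduction_start : stack :=
  insub_bseq _ (map cmd [:: DeclareX; DeclareY; Main]).

Definition reduction_machine : machine :=
  @Machine 2 void stack reduction_start (fun q => val q == [::])
    reduction_transition.

Notation config := (config reduction_machine).
Notation step := (@step reduction_machine).

(** * Its runs *)

Definition eqt (t t' : tapev) : Prop :=
  nth None t.1 =1 nth None t'.1 /\ nth None t.2 =1 nth None t'.2.

Lemma eqt_refl t : eqt t t. Proof. by []. Qed.

Lemma eqt_trans t2 t1 t3 : eqt t1 t2 -> eqt t2 t3 -> eqt t1 t3.
Proof. by move=> [l12 r12] [l23 r23]; split=> i; rewrite ?l12 ?r12. Qed.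

Lemma eqt_read t t' : eqt t t' -> read t = read t'.
Proof. by move=> [_ /(_ 0)]; rewrite !nth0. Qed.

(** Writing back a scanned blank may list a cell that was unlisted, which is why tapes are compared
    by [eqt] rather than by equality. *)
Lemma eqt_stay t : eqt (write_move t (read t, Stay)) t.
Proof. by case: t => l [|c r]; split=> //= -[|[]]. Qed.

Lemma eqt_write_move t t' x : eqt t t' -> eqt (write_move t x) (write_move t' x).
Proof.
case: t t' x => [l r] [l' r'] [c d] [/= el er].
have eh : head None l = head None l' by rewrite -!nth0.
have ehr : head None (behead r) = head None (behead r') by rewrite -!nth0 !nth_behead.
by rewrite /write_move /=; case: d; split=> -[|[|i]] //=;
  rewrite ?eh ?ehr ?nth_behead //; apply: el || apply: er.
Qed.

(** A word contains no blank, so a list that agrees with it cell by cell is that word followed by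
    listed blanks. *)
Lemma eqt_cells t (l r : seq symbol) : eqt t (word_cells _ l, word_cells _ r) ->
  exists i j, t = (word_cells _ l ++ nseq i None, word_cells _ r ++ nseq j None).
Proof.
have main (s : seq cellv) (w : seq symbol) : nth None s =1 nth None (word_cells _ w) ->
    exists i, s = word_cells _ w ++ nseq i None.
  elim: w s => [|a w IH] [|x s] e //=.
  - by exists 0.
  - exists (size s).+1; apply: (@eq_from_nth _ None); first by rewrite /= size_nseq.
    by move=> i _; rewrite e nth_nseq nth_nil; case: ifP.
  - by have := e 0.
  - have [i ->] := IH s (fun i => e i.+1).
    by exists i; have := e 0 => /= ->.
case: t => tl tr [/= /main[i ->] /main[j ->]]; by exists i, j.
Qed.

(* A configuration up to blank cells at the ends of the tapes: the stack, the
   input tape, the counter tape and the output written so far. *)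
Record view := View {
  v_stack : seq instr; v_input : tapev; v_counter : tapev; v_output : seq symbol }.

Definition shows (C : config) (v : view) : Prop :=
  [/\ val C.1 = v_stack v, eqt (C.2 ord0) (v_input v),
      eqt (C.2 (inord 1)) (v_counter v)
    & eqt (C.2 ord_max) (word_cells _ (rev (v_output v)), [::])].

(** Starting from any configuration that shows [v] makes runs composable; an upper bound [k]
    replaces the exact count of steps. *)
Definition reaches (k : nat) (v v' : view) : Prop :=
  forall C, shows C v -> exists2 k', k' <= k & shows (iter k' step C) v'.

Lemma reaches_refl v : reaches 0 v v.
Proof. by move=> C Cv; exists 0. Qed.

Lemma reaches_trans k1 k2 v1 v2 v3 k :
  reaches k1 v1 v2 -> reaches k2 v2 v3 -> k1 + k2 <= k -> reaches k v1 v3.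
Proof.
move=> h12 h23 le_k C /h12[i ik /h23[j jk e]]; exists (j + i); first by lia.
by rewrite iterD.
Qed.

Lemma reaches_le k k' v v' : reaches k v v' -> k <= k' -> reaches k' v v'.
Proof. by move=> h kk C /h[i ik e]; exists i => //; apply: leq_trans kk. Qed.

(** The size hypothesis keeps [insub_bseq] from replacing an oversized stack by a default. *)
Lemma reaches_exec o rest ti tc ti' tc' out :
    let a := exec o (read ti) (read tc) in
    size (act_next a ++ rest) <= stack_bound ->
    eqt (write_move ti (read ti, act_input a)) ti' ->
    eqt (write_move tc (act_counter a)) tc' ->
  reaches 1 (View (o :: rest) ti tc out)
            (View (act_next a ++ rest) ti' tc' (out ++ seq_of_opt (act_output a))).
Proof.
move=> a sz eti etc [q ts] [/= eq0 e0 e1 e2]; exists 1 => //=.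
rewrite /Defs.step /= eq0 /= /reduction_transition /= eq0 !ffunE.
rewrite (eqt_read e0) (eqt_read e1) -/a.
have i1 : (inord 1 : 'I_3) == ord0 = false by rewrite -val_eqE /= inordK.
have i1' : (inord 1 : 'I_3) == ord_max = false by rewrite -val_eqE /= inordK.
split=> /=.
- by rewrite /insub_bseq insubdK.
- rewrite !ffunE /= (eqt_read e0); apply: eqt_trans eti; exact: eqt_write_move.
- rewrite !ffunE i1 i1'; apply: eqt_trans etc; exact: eqt_write_move.
- rewrite !ffunE /= (eqt_read e2).
  case: (act_output a) => [s|] /=; apply: (eqt_trans (eqt_write_move _ e2)).
    by rewrite /write_move /= cats1 rev_rcons; apply: eqt_refl.
  by rewrite cats0; apply: eqt_stay.
Qed.

(** Replacing an instruction by at most one other does not lengthen the stack, so the bound comes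
    from the configuration itself. *)
Lemma reaches_exec1 o rest ti tc ti' tc' out next out' :
    let a := exec o (read ti) (read tc) in
    act_next a ++ rest = next -> size (act_next a) <= 1 ->
    eqt (write_move ti (read ti, act_input a)) ti' ->
    eqt (write_move tc (act_counter a)) tc' ->
    out ++ seq_of_opt (act_output a) = out' ->
  reaches 1 (View (o :: rest) ti tc out) (View next ti' tc' out').
Proof.
move=> a <- sz eti etc <- C Cv; apply: (reaches_exec _ eti etc) => //.
case: Cv => /= eq0 _ _ _; have := size_bseq (C.1); rewrite eq0; apply: leq_trans.
by rewrite size_cat -[size (_ :: _)]add1n leq_add2r.
Qed.

(** * Scanning, copying and incrementing words on the tapes *)

Definition zip (l r : seq symbol) : tapev := (word_cells _ l, word_cells _ r).

(* The head is just to the left of [r]. *)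
Definition left_of (l r : seq symbol) : tapev :=
  (behead (word_cells _ l), head None (word_cells _ l) :: word_cells _ r).

Lemma eqt_left l r : eqt (write_move (zip l r) (read (zip l r), GoLeft)) (left_of l r).
Proof. by case: r => [|s r]; split=> //= -[|[|i]] //=; rewrite nth_nil. Qed.

Lemma eqt_left_of_nil r : eqt (write_move (left_of [::] r) (None, GoRight)) (zip [::] r).
Proof. by split=> // -[|i] //=; rewrite nth_nil. Qed.

Lemma reaches_emit w rest ti tc out :
  reaches (size w) (View (emit w ++ rest) ti tc out) (View rest ti tc (out ++ w)).
Proof.
elim: w out => [|s w IH] out; first by rewrite cats0; apply: reaches_refl.
apply: (reaches_trans (v2 := View (emit w ++ rest) ti tc (rcons out s))).
- by apply: reaches_exec1 => //=; rewrite ?cats1 //; apply: eqt_stay.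
- by rewrite -cat_rcons; apply: IH.
- by rewrite add1n.
Qed.

Lemma reaches_rewind rest ti l r out :
  reaches (size l).+1 (View (cmd Rewind :: rest) ti (left_of l r) out)
                      (View rest ti (zip [::] (rev l ++ r)) out).
Proof.
elim: l r => [|s l IH] r.
  by apply: reaches_exec1 => //=; rewrite ?cats0 //; [exact: eqt_stay | exact: eqt_left_of_nil].
apply: (reaches_trans (v2 := View (cmd Rewind :: rest) ti (left_of l (s :: r)) out)).
- by apply: reaches_exec1 => //=; rewrite ?cats0 //; exact: eqt_stay.
- by rewrite rev_cons cat_rcons; apply: IH.
- by rewrite add1n.
Qed.

(** One pass to the blank after the word and one back, each of [size w + 1] steps. *)
Lemma reaches_copy rest ti w out :
  reaches (2 * size w + 2) (View (cmd Copy :: cmd Rewind :: rest) ti (zip [::] w) out)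
                        (View rest ti (zip [::] w) (out ++ w)).
Proof.
have scan l r out' : reaches (size r).+1
    (View (cmd Copy :: cmd Rewind :: rest) ti (zip l r) out')
    (View (cmd Rewind :: rest) ti (left_of (rev r ++ l) [::]) (out' ++ r)).
  elim: r l out' => [|s r IH] l out'.
    apply: reaches_exec1 => //=; first exact: eqt_stay.
    by apply: eqt_trans (eqt_left _ _) _; apply: eqt_refl.
  apply: (reaches_trans (v2 := View (cmd Copy :: cmd Rewind :: rest) ti
                                    (zip (s :: l) r) (rcons out' s))).
  - by apply: reaches_exec1 => //=; rewrite ?cats1 //; apply: eqt_stay.
  - by rewrite rev_cons cat_rcons -(cat_rcons _ out'); apply: IH.
  - by rewrite add1n.
have := @reaches_rewind rest ti (rev w ++ [::]) [::] (out ++ w).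
rewrite !cats0 revK size_rev => rew; apply: reaches_trans (scan [::] w out) _ _.
  by rewrite cats0; apply: rew.
by lia.
Qed.

(** Binary successor, least significant bit first; [behead] treats alike a [Zero] that stops the
    carry and the end of the numeral. *)
Fixpoint increment (w : seq symbol) : seq symbol :=
  match w with
  | One :: w' => Zero :: increment w'
  | _ => One :: behead w
  end.

Lemma reaches_incr rest ti w out :
  reaches (2 * size w + 2) (View (cmd Incr :: cmd Rewind :: rest) ti (zip [::] w) out)
                        (View rest ti (zip [::] (increment w)) out).
Proof.
(* [l] holds the digits already passed; each further [One] costs one step now and one in the
   rewind. *)
have scan l r : reaches (2 * size r + size l + 2)
    (View (cmd Incr :: cmd Rewind :: rest) ti (zip l r) out)
    (View rest ti (zip [::] (rev l ++ increment r)) out).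
  elim: r l => [|s r IH] l.
    apply: reaches_trans
      (_ : reaches 1 _ (View (cmd Rewind :: rest) ti (left_of l [:: One]) out))
      (@reaches_rewind _ _ _ _ _) _ => //=; last by lia.
    apply: reaches_exec1 => //=; rewrite ?cats0 //; exact: eqt_stay.
  case: (boolP (s == One)) => [/eqP -> | sN].
    apply: (reaches_trans (v2 := View (cmd Incr :: cmd Rewind :: rest) ti (zip (Zero :: l) r) out)).
    - by apply: reaches_exec1 => //=; rewrite ?cats0 //; exact: eqt_stay.
    - by rewrite /= -cat_rcons -rev_cons; apply: IH.
    - by rewrite /=; lia.
  have -> : increment (s :: r) = One :: r by case: s sN.
  apply: reaches_trans
      (_ : reaches 1 _ (View (cmd Rewind :: rest) ti (left_of l (One :: r)) out))
      (@reaches_rewind _ _ _ _ _) _ => //=; last by lia.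
  by apply: reaches_exec1 => //=; case: s sN => //=; rewrite ?cats0 // => _; exact: eqt_stay.
by apply: reaches_le (scan [::] w) _; rewrite /=; lia.
Qed.

Definition is_bit (s : symbol) : bool := (s == Zero) || (s == One).

Lemma reaches_bits rest l w x r tc out : all is_bit w -> ~~ is_bit x ->
  reaches (size w).+1 (View (cmd Bits :: rest) (zip l (w ++ x :: r)) tc out)
                      (View rest (zip (rev w ++ l) (x :: r)) tc (out ++ w)).
Proof.
move=> + xN; elim: w l out => [|s w IH] l out /= => [_ | /andP[bs bw]].
  by apply: reaches_exec1 => //=; case: x xN => //= _;
    rewrite ?cats0 //; exact: eqt_stay.
apply: (reaches_trans (v2 := View (cmd Bits :: rest) (zip (s :: l) (w ++ x :: r)) tc (rcons out s))).
- by apply: reaches_exec1 => //=; case: s bs => //= _; rewrite ?cats1 //; exact: eqt_stay.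
- by rewrite rev_cons cat_rcons -(cat_rcons _ out); apply: IH.
- by rewrite add1n.
Qed.

Lemma increment_positive n : increment (positive_code n) = positive_code (PosDef.Pos.succ n).
Proof. by elim: n => //= n ->. Qed.

Lemma nat_code_increment n : nat_code n.+1 = increment (nat_code n).
Proof.
rewrite /nat_code; case e: (bin_of_nat n) => [|q].
  have -> // : n = 0 by rewrite -[n]bin_of_natK e.
rewrite increment_positive.
have -> : bin_of_nat n.+1 = BinNums.Npos (PosDef.Pos.succ q).
  apply: (can_inj nat_of_binK); rewrite bin_of_natK /= nat_of_succ_pos.
  by rewrite -[n]bin_of_natK e.
by [].
Qed.

Lemma nat_code_bits n : all is_bit (nat_code n).
Proof. by rewrite /nat_code; case: bin_of_nat => //; elim. Qed.

(** A linear bound on the logarithmic length is enough for polynomial time. *)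
Lemma size_nat_code n : size (nat_code n) <= n.
Proof.
have szi w : size (increment w) <= (size w).+1 by elim: w => //= -[].
elim: n => // n IH; rewrite nat_code_increment; exact: leq_trans (szi _) _.
Qed.

(** * Translating the clauses one after the other *)

Definition cnf_literal_code (l : bool * nat) : seq symbol :=
  (if l.1 then Pos else Neg) :: nat_code l.2.
Definition xor_literal_code (l : nat * nat) : seq symbol :=
  Var :: nat_code l.1 ++ At :: nat_code l.2.
Definition literals_code (c : seq (bool * nat)) : seq symbol :=
  flatten (map cnf_literal_code c).

(** With no literal left the head is on [Close] and stays there. The bound 76 leaves room for the
    four instructions that replace [Literal]. *)
Lemma reaches_literal rest l c r tc out : size rest <= 76 ->
  reaches (size (literals_code (take 1 c)) + 4)
    (View (cmd Literal :: rest) (zip l (literals_code c ++ Close :: r)) tc out)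
    (View rest (zip (rev (literals_code (take 1 c)) ++ l)
                    (literals_code (drop 1 c) ++ Close :: r)) tc
      (out ++ flatten (map xor_literal_code (map true_literal (take 1 c))))).
Proof.
move=> rest_le; case: c => [|[b v] c].
  apply: (@reaches_le 1) => //.
  by apply: reaches_exec1 => //=; rewrite ?cats0 //; exact: eqt_stay.
set sgn := if b then Pos else Neg.
have -> : literals_code ((b, v) :: c) ++ Close :: r =
          sgn :: nat_code v ++ (literals_code c ++ Close :: r).
  by rewrite /literals_code /= -catA.
rewrite [take _ _]/= [drop _ _]/= drop0 take0.
(* The numeral of [v] is delimited by the sign of the next literal or by [Close], which stops
   [Bits]. *)
have [x [r' [-> xN]]] : exists x r', literals_code c ++ Close :: r = x :: r' /\ ~~ is_bit x.
  case: c => [|[b' v'] c]; first by exists Close, r.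
  by exists (if b' then Pos else Neg), ((nat_code v' ++ literals_code c) ++ Close :: r);
     case: b'.
have sz_b : size (nat_code b) <= 1 by case: b @sgn.
apply: (@reaches_trans 1 (size (nat_code v) + 4) _
  (View (emit [:: Var] ++ cmd Bits :: emit (At :: nat_code b) ++ rest)
        (zip (sgn :: l) (nat_code v ++ x :: r')) tc out)).
- have -> : emit [:: Var] ++ cmd Bits :: emit (At :: nat_code b) ++ rest =
      act_next (exec (cmd Literal) (sym sgn) (read tc)) ++ rest.
    by rewrite /sgn; case: (b).
  rewrite -[out in X in reaches _ _ X]cats0.
  have -> : [::] = seq_of_opt (act_output (exec (cmd Literal) (sym sgn) (read tc))).
    by rewrite /sgn; case: (b).
  apply: reaches_exec.
  + rewrite size_cat; apply: leq_trans (leq_add (_ : _ <= 4) rest_le) _ => //.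
    by rewrite /sgn; case: (b).
  + by rewrite /sgn; case: (b); exact: eqt_refl.
  + by rewrite /sgn; case: (b); exact: eqt_stay.
- apply: (reaches_trans (@reaches_emit [:: Var] _ _ _ _) (k2 := size (nat_code v) + 3))
    => /=; last by lia.
  apply: (reaches_trans (@reaches_bits _ _ _ _ _ _ _ _ _) (k2 := 2)) => //.
  + exact: nat_code_bits.
  + rewrite /literals_code /= !cats0 rev_cons cat_rcons.
    have -> : out ++ Var :: nat_code v ++ At :: nat_code b =
        ((out ++ [:: Var]) ++ nat_code v) ++ At :: nat_code b by rewrite -!catA.
    apply: reaches_le (@reaches_emit (At :: nat_code b) rest _ _ _) _.
    by rewrite /= ltnS.
  + by lia.
- by rewrite /literals_code /= cats0; lia.
Qed.

(** Per state: one step for [Var], [2 * size (nat_code N) + 2] for the copy, and at most 7 for [At]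
    and the numeral of a number below 7. *)
Lemma reaches_gadget_states N S rest ti out : all (fun s => s < 7) S ->
  reaches (size S * (2 * size (nat_code N) + 10))
    (View (states_code S ++ rest) ti (zip [::] (nat_code N)) out)
    (View rest ti (zip [::] (nat_code N))
       (out ++ flatten (map xor_literal_code [seq (N, s) | s <- S]))).
Proof.
elim: S out => [|s S IH] out; first by rewrite cats0 => _; apply: reaches_refl.
move=> /andP[s7 /IH{}IH]; 
have -> : states_code (s :: S) ++ rest =
    emit [:: Var] ++ cmd Copy :: cmd Rewind :: emit (At :: nat_code s) ++
      states_code S ++ rest by rewrite /states_code /= -catA.
apply: (reaches_trans (v2 := View _ _ _ _)); first exact: (@reaches_emit [:: Var] _ _ _ _).
  apply: (reaches_trans (v2 := View _ _ _ _)); first exact: (@reaches_copy _ _ _ _).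
    apply: (reaches_trans (v2 := View _ _ _ _)); first exact: (@reaches_emit (At :: nat_code s) _ _ _ _).
      have := IH (((out ++ [:: Var]) ++ nat_code N) ++ At :: nat_code s).
      by rewrite /= -!catA /=; apply.
    exact: leqnn.
  exact: leqnn.
have := size_nat_code s; rewrite /=; lia.
Qed.

Definition xor_clause_code (c : seq (nat * nat)) : seq symbol :=
  Open :: rcons (flatten (map xor_literal_code c)) Close.

Lemma reaches_gadget_clause N S c rest l r out :
    all (fun s => s < 7) S -> size S = 3 -> size (gadget_code S ++ rest) <= 77 ->
  reaches (size (literals_code (take 1 c)) + 6 * size (nat_code N) + 36)
    (View (gadget_code S ++ rest) (zip l (literals_code c ++ Close :: r))
          (zip [::] (nat_code N)) out)
    (View rest (zip (rev (literals_code (take 1 c)) ++ l)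
                    (literals_code (drop 1 c) ++ Close :: r)) (zip [::] (nat_code N))
      (out ++ xor_clause_code (gadget_clause N c S))).
Proof.
move=> S7 S3 sz.
rewrite /gadget_code /= -catA.
apply: (reaches_trans (v2 := View _ _ _ _)); first exact: (@reaches_emit [:: Open] _ _ _ _).
  apply: (reaches_trans (v2 := View _ _ _ _)).
  - apply: (@reaches_literal _ _ _ _ _ _).
    by move: sz; rewrite /gadget_code /= -catA => /(@ltnW _ 76).
  - apply: (reaches_trans (v2 := View _ _ _ _)).
    + exact: (@reaches_gadget_states _ _ _ _ _ S7).
    + have -> : out ++ xor_clause_code (gadget_clause N c S) =
          (((out ++ [:: Open]) ++
            flatten (map xor_literal_code (map true_literal (take 1 c)))) ++
           flatten (map xor_literal_code [seq (N, s) | s <- S])) ++ [:: Close].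
        by rewrite /xor_clause_code /gadget_clause map_cat flatten_cat -cats1 -!catA.
      exact: (@reaches_emit [:: Close] rest).
    + exact: leqnn.
  - exact: leqnn.
by rewrite S3 /=; lia.
Qed.

Definition cnf_clause_code (c : seq (bool * nat)) : seq symbol :=
  Open :: rcons (literals_code c) Close.

Lemma reaches_clause N c l r out : size c <= 3 ->
  reaches (size (cnf_clause_code c) + 20 * size (nat_code N) + 112)
    (View [:: cmd Main] (zip l (cnf_clause_code c ++ r)) (zip [::] (nat_code N)) out)
    (View [:: cmd Main] (zip (rev (cnf_clause_code c) ++ l) r) (zip [::] (nat_code N.+1))
      (out ++ flatten (map xor_clause_code (gadget N c)))).
Proof.
move=> c3.
have -> : cnf_clause_code c ++ r = Open :: literals_code c ++ Close :: r.
  by rewrite /cnf_clause_code /= cat_rcons.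
set ti := zip l _.
set bs := nat_code N.
have enter : reaches 1 (View [:: cmd Main] ti (zip [::] bs) out)
    (View clause_program (zip (Open :: l) (literals_code c ++ Close :: r)) (zip [::] bs) out).
  have := @reaches_exec (cmd Main) [::] ti (zip [::] bs)
    (zip (Open :: l) (literals_code c ++ Close :: r)) (zip [::] bs) out.
  by rewrite /= !cats0; apply => //; exact: eqt_stay.
(* Stack, left part of the input tape and output just before the i-th gadget clause is written. *)
pose P i := flatten [seq gadget_code (falsifying i) | i <- iota i (3 - i)] ++
             map cmd [:: Skip; Incr; Rewind; Main].
pose L i := rev (literals_code (take i c)) ++ Open :: l.
pose X i := out ++ flatten
  [seq xor_clause_code (gadget_clause N (drop i c) (falsifying i)) | i <- iota 0 i].
have loop i : i < 3 -> reaches (size (literals_code (take 1 (drop i c))) + 6 * size bs + 36)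
    (View (P i) (zip (L i) (literals_code (drop i c) ++ Close :: r)) (zip [::] bs) (X i))
    (View (P i.+1) (zip (L i.+1) (literals_code (drop i.+1 c) ++ Close :: r)) (zip [::] bs)
          (X i.+1)).
  move=> i3.
  have -> : P i = gadget_code (falsifying i) ++ P i.+1.
    rewrite /P -[in LHS](subnSK i3) /= -catA //.
  have -> : X i.+1 = X i ++ xor_clause_code (gadget_clause N (drop i c) (falsifying i)).
    by rewrite /X -[i.+1]addn1 iotaD map_cat flatten_cat catA /= cats0.
  have -> : L i.+1 = rev (literals_code (take 1 (drop i c))) ++ L i.
    by rewrite /L catA -rev_cat /literals_code -flatten_cat -map_cat -takeD addn1.
  rewrite -[i.+1]add1n -drop_drop.
  by apply: reaches_gadget_clause; case: i i3 => [|[|[|]]].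
(* With at most three literals, the three gadget clauses read the whole clause. *)
have lits : size (literals_code c) = size (literals_code (take 1 (drop 0 c))) +
    size (literals_code (take 1 (drop 1 c))) + size (literals_code (take 1 (drop 2 c))).
  rewrite -!size_cat /literals_code -!flatten_cat -!map_cat.
  by congr (size (flatten (map _ _))); case: (c) c3 => [|? [|? [|? []]]].
have exit : reaches (2 * size bs + 3)
    (View (P 3) (zip (L 3) (literals_code (drop 3 c) ++ Close :: r)) (zip [::] bs) (X 3))
    (View [:: cmd Main] (zip (rev (cnf_clause_code c) ++ l) r) (zip [::] (nat_code N.+1))
      (out ++ flatten (map xor_clause_code (gadget N c)))).
  rewrite drop_oversize // /P /L take_oversize //= nat_code_increment.
  apply: (@reaches_trans 1 (2 * size bs + 2) _ (View (map cmd [:: Incr; Rewind; Main])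
     (zip (rev (cnf_clause_code c) ++ l) r) (zip [::] bs) (X 3))).
  - apply: reaches_exec1; rewrite ?cats0 //; last exact: eqt_stay.
    by rewrite /cnf_clause_code rev_cons rev_rcons cat_rcons; exact: eqt_refl.
  - have -> : X 3 = out ++ flatten (map xor_clause_code (gadget N c)).
      by rewrite /gadget -map_comp.
    exact: (@reaches_incr [:: cmd Main]).
  - by lia.
have body : reaches (size (literals_code c) + 18 * size bs + 108)
    (View clause_program (zip (Open :: l) (literals_code c ++ Close :: r)) (zip [::] bs) out)
    (View (P 3) (zip (L 3) (literals_code (drop 3 c) ++ Close :: r)) (zip [::] bs) (X 3)).
  have -> : View clause_program (zip (Open :: l) (literals_code c ++ Close :: r)) (zip [::] bs) out =
      View (P 0) (zip (L 0) (literals_code (drop 0 c) ++ Close :: r)) (zip [::] bs) (X 0).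
    by rewrite /L /X take0 cats0 drop0.
  apply: (reaches_trans (loop 0 isT) (reaches_trans (loop 1 isT) (loop 2 isT) (leqnn _))).
  by rewrite lits; lia.
apply: (reaches_trans enter (reaches_trans body exit (leqnn _))).
by rewrite /cnf_clause_code /= size_rcons; lia.
Qed.

Definition clauses_code (cs : seq (seq (bool * nat))) : seq symbol :=
  flatten (map cnf_clause_code cs).

Lemma clauses_code_cons c cs :
  clauses_code (c :: cs) = cnf_clause_code c ++ clauses_code cs.
Proof. by []. Qed.

Lemma reaches_clauses N B cs l r out : all (fun c => size c <= 3) cs ->
    N + size cs <= B ->
  reaches (size (clauses_code cs) * (20 * B + 113))
    (View [:: cmd Main] (zip l (clauses_code cs ++ r))
          (zip [::] (nat_code N)) out)
    (View [:: cmd Main] (zip (rev (clauses_code cs) ++ l) r)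
          (zip [::] (nat_code (N + size cs)))
      (out ++ flatten (map xor_clause_code (gadgets N cs)))).
Proof.
elim: cs N l out => [|c cs IH] N l out.
  by rewrite cats0 addn0 => _ _; apply: reaches_refl.
move=> /andP[c3 cs3] NB; rewrite /= in NB.
rewrite clauses_code_cons -catA.
apply: (reaches_trans (@reaches_clause _ _ _ _ _ c3)).
  have := @IH N.+1 (rev (cnf_clause_code c) ++ l)
            (out ++ flatten (map xor_clause_code (gadget N c))) cs3.
  rewrite gadgets_cons map_cat flatten_cat rev_cat -!catA addSnnS; exact.
(* The code of a clause is nonempty, so the overhead of at most [20 * B + 112] can be charged to its
   symbols. *)
rewrite size_cat mulnDl leq_add2r.
have szN := size_nat_code N.
have : 0 < size (cnf_clause_code c) by [].
by set k := size _; nia.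
Qed.

(** Started at 0, this count brings the counter to the index of the first gadget variable. *)
Lemma reaches_variables n N B l r out : N + n <= B ->
  reaches (n * (2 * B + 3))
    (View [:: cmd Main] (zip l (nseq n Var ++ r)) (zip [::] (nat_code N)) out)
    (View [:: cmd Main] (zip (nseq n Var ++ l) r) (zip [::] (nat_code (N + n))) out).
Proof.
elim: n N l => [|n IH] N l NB; first by rewrite addn0; apply: reaches_refl.
have -> : nseq n.+1 Var ++ l = nseq n Var ++ Var :: l.
  by elim: (n) => //= k <-.
have NE : N + n.+1 = N.+1 + n by rewrite addnS.
rewrite NE; set ti := zip l _; set ti' := zip (Var :: l) (nseq n Var ++ r).
have szN := size_nat_code N.
apply: (@reaches_trans 1 (2 * size (nat_code N) + 2 + n * (2 * B + 3)) _
  (View (map cmd [:: Incr; Rewind; Main]) ti' (zip [::] (nat_code N)) out)).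
- have := @reaches_exec (cmd Main) [::] ti (zip [::] (nat_code N)) ti' (zip [::] (nat_code N)) out.
  by rewrite /= cats0; apply => //; exact: eqt_stay.
- apply: (reaches_trans (@reaches_incr [:: cmd Main] _ _ _) _ (leqnn _)).
  by rewrite -nat_code_increment; apply: IH; rewrite -NE.
- by rewrite mulSn; lia.
Qed.

(** * The two passes that declare the variables *)

Definition declare_X (s : symbol) : seq symbol :=
  match s with
  | Var => [:: VarX; State; State]
  | Open => VarX :: nseq 7 State
  | _ => [::]
  end.

Definition declare_Y (s : symbol) : seq symbol :=
  match s with Var | Open => [:: VarY; State] | _ => [::] end.

(** Nine steps per symbol: one to read it and at most eight to write a declaration. The head ends on
    the last symbol, ready for the backward pass. *)
Lemma reaches_declare_X w rest l tc out : size rest <= 71 ->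
  reaches (9 * size w + 1)
    (View (cmd DeclareX :: rest) (zip l w) tc out)
    (View rest (left_of (rev w ++ l) [::]) tc (out ++ flatten (map declare_X w))).
Proof.
move=> rest_le; elim: w l out => [|s w IH] l out.
  by apply: reaches_exec1 => //; [exact: eqt_left | exact: eqt_stay].
have -> : out ++ flatten (map declare_X (s :: w)) =
    (out ++ declare_X s) ++ flatten (map declare_X w) by rewrite -catA.
rewrite rev_cons cat_rcons.
have sz : size (declare_X s) <= 8 by case: (s).
apply: (@reaches_trans 1 (size (declare_X s) + (9 * size w + 1)) _
  (View (emit (declare_X s) ++ cmd DeclareX :: rest) (zip (s :: l) w) tc out)).
- have -> : emit (declare_X s) ++ cmd DeclareX :: rest =
      act_next (exec (cmd DeclareX) (sym s) (read tc)) ++ rest by case: (s).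
  rewrite -[out in X in reaches _ _ X]cats0.
  have -> : [::] = seq_of_opt (act_output (exec (cmd DeclareX) (sym s) (read tc))).
    by case: (s).
  apply: reaches_exec.
  + rewrite size_cat; apply: leq_trans (leq_add (_ : _ <= 9) rest_le) _ => //.
    by case: (s).
  + by case: (s); exact: eqt_refl.
  + by case: (s); exact: eqt_stay.
- apply: (reaches_trans (@reaches_emit _ _ _ _ _) _ (leqnn _)); exact: IH.
- by rewrite /=; lia.
Qed.

(** Besides declaring the variables of Y, this pass brings the head back to the start of the
    input. *)
Lemma reaches_declare_Y l rest r tc out : size rest <= 71 ->
  reaches (3 * size l + 1)
    (View (cmd DeclareY :: rest) (left_of l r) tc out)
    (View rest (zip [::] (rev l ++ r)) tc (out ++ flatten (map declare_Y l))).
Proof.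
move=> rest_le; elim: l r out => [|s l IH] r out.
  by apply: reaches_exec1 => //; [exact: eqt_left_of_nil | exact: eqt_stay].
have -> : out ++ flatten (map declare_Y (s :: l)) =
    (out ++ declare_Y s) ++ flatten (map declare_Y l) by rewrite -catA.
rewrite rev_cons cat_rcons.
have sz : size (declare_Y s) <= 2 by case: (s).
apply: (@reaches_trans 1 (size (declare_Y s) + (3 * size l + 1)) _
  (View (emit (declare_Y s) ++ cmd DeclareY :: rest) (left_of l (s :: r)) tc out)).
- have -> : emit (declare_Y s) ++ cmd DeclareY :: rest =
      act_next (exec (cmd DeclareY) (sym s) (read tc)) ++ rest by case: (s).
  rewrite -[out in X in reaches _ _ X]cats0.
  have -> : [::] = seq_of_opt (act_output (exec (cmd DeclareY) (sym s) (read tc))).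
    by case: (s).
  apply: reaches_exec.
  + rewrite size_cat; apply: leq_trans (leq_add (_ : _ <= 9) rest_le) _ => //.
    by case: (s).
  + by case: (s); exact: eqt_refl.
  + by case: (s); exact: eqt_stay.
- apply: (reaches_trans (@reaches_emit _ _ _ _ _) _ (leqnn _)); exact: IH.
- by rewrite /=; lia.
Qed.

(** * The output word and the complete run *)

Lemma cnf_codeE phi :
  cnf_code phi = nseq (cnf_nvars phi) Var ++ clauses_code (cnf_clauses phi).
Proof. by []. Qed.

(** [Var] occurs once per Boolean variable and [Open] once per clause, hence once per gadget
    variable. *)
Definition declares (s : symbol) : bool := (s == Var) || (s == Open).

Lemma literals_code_declares c : ~~ has declares (literals_code c).
Proof.
rewrite -all_predC; elim: c => [|[b v] c IH] //.
have -> : literals_code ((b, v) :: c) = cnf_literal_code (b, v) ++ literals_code c by [].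
rewrite all_cat IH andbT /=; apply/andP; split; first by case: b.
by apply: sub_all (nat_code_bits v); case.
Qed.

Lemma clause_declares c : count declares (cnf_clause_code c) = 1.
Proof.
have c0 : count declares (literals_code c) = 0.
  by apply/eqP; rewrite -leqn0 leqNgt -has_count literals_code_declares.
by rewrite /= -cats1 count_cat c0.
Qed.

Lemma declare_X_clause c :
  flatten (map declare_X (cnf_clause_code c)) = VarX :: nseq 7 State.
Proof.
have lits0 : flatten (map declare_X (literals_code c)) = [::].
  have := literals_code_declares c; rewrite -all_predC.
  by elim: (literals_code c) => //= s w IH /andP[sN /IH ->]; case: s sN.
by rewrite /cnf_clause_code -cats1 /= map_cat flatten_cat lits0.
Qed.

Lemma flatten_declare_X phi : flatten (map declare_X (cnf_code phi)) =
  flatten (nseq (cnf_nvars phi) [:: VarX; State; State] ++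
           nseq (size (cnf_clauses phi)) (VarX :: nseq 7 State)).
Proof.
rewrite cnf_codeE map_cat !flatten_cat map_nseq; congr (_ ++ _).
elim: (cnf_clauses phi) => // c cs IH.
by rewrite clauses_code_cons map_cat flatten_cat declare_X_clause IH.
Qed.

Lemma count_declares phi :
  count declares (cnf_code phi) = cnf_nvars phi + size (cnf_clauses phi).
Proof.
rewrite cnf_codeE count_cat count_nseq mul1n; congr (_ + _).
elim: (cnf_clauses phi) => // c cs IH.
by rewrite clauses_code_cons count_cat clause_declares IH.
Qed.

Lemma flatten_declare_Y w :
  flatten (map declare_Y w) = flatten (nseq (count declares w) [:: VarY; State]).
Proof. by elim: w => // s w IH; rewrite /= IH; case: s. Qed.

(** One factor for each pass of the machine. The reversal is harmless, since all declarations for Y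
    are equal and only their number counts. *)
Lemma position_codeE phi : position_code (reduction phi) =
  flatten (map declare_X (cnf_code phi)) ++
  flatten (map declare_Y (rev (cnf_code phi))) ++
  flatten (map xor_clause_code (gadgets (cnf_nvars phi) (cnf_clauses phi))).
Proof.
rewrite flatten_declare_X flatten_declare_Y count_rev count_declares.
by rewrite /position_code /= !map_cat !flatten_cat !map_nseq /= -!catA.
Qed.

Lemma reduction_reaches phi : is_3cnf phi ->
  reaches (150 * size (cnf_code phi) ^ 2 + 150)
    (View (map cmd [:: DeclareX; DeclareY; Main]) (zip [::] (cnf_code phi)) (zip [::] [::]) [::])
    (View [::] (zip (rev (cnf_code phi)) [::])
       (zip [::] (nat_code (cnf_nvars phi + size (cnf_clauses phi))))
       (position_code (reduction phi))).
Proof.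
move=> phi3; set w := cnf_code phi; set n := cnf_nvars phi; set cs := cnf_clauses phi.
have cs3 : all (fun c => size c <= 3) cs.
  by apply/allP => c /(allP phi3)/andP[].
(* Each variable and each clause has its own symbol in the code, so the input length bounds every
   index. *)
have nm : n + size cs <= size w by rewrite -count_declares count_size.
have wE : size w = n + size (clauses_code cs).
  by rewrite /w cnf_codeE size_cat size_nseq.
have sX := @reaches_declare_X w (map cmd [:: DeclareY; Main]) [::] (zip [::] [::]) [::] isT.
have sY := @reaches_declare_Y (rev w) (map cmd [:: Main]) [::] (zip [::] [::])
  (flatten (map declare_X w)) isT.
rewrite revK cats0 in sY; rewrite cats0 in sX.
set out := _ ++ flatten (map declare_Y (rev w)) in sY.
have sV := @reaches_variables n 0 (size w) [::] (clauses_code cs) out.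
have {}sV := sV (leq_trans (leq_addr _ _) nm); rewrite add0n cats0 in sV.
have sC := @reaches_clauses n (size w) cs (nseq n Var) [::] out cs3 nm.
rewrite cats0 in sC.
have revw : rev (clauses_code cs) ++ nseq n Var = rev w.
  by rewrite /w cnf_codeE rev_cat rev_nseq.
rewrite revw in sC.
set p := (out ++ _) in sC.
have pE : p = position_code (reduction phi) by rewrite position_codeE /p /out -catA.
have sE : reaches 1 (View [:: cmd Main] (zip (rev w) [::]) (zip [::] (nat_code (n + size cs))) p)
   (View [::] (zip (rev w) [::]) (zip [::] (nat_code (n + size cs))) p).
  by apply: reaches_exec1 => //; rewrite ?cats0 //; exact: eqt_stay.
rewrite -pE.
apply: (reaches_trans sX (reaches_trans sY (reaches_trans sV (reaches_trans sC sE
  (leqnn _)) (leqnn _)) (leqnn _))).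
(* The declarations cost [12 * L + 2] steps, the third pass at most [L * (20 * L + 113)] and the
   halt one step. *)
by rewrite size_rev; move: wE; set L := size w; set k := size _ => wE; nia.
Qed.

Lemma reduction_outputs phi : is_3cnf phi ->
  outputs_within reduction_machine (150 * size (cnf_code phi) ^ 2 + 150)
    (cnf_code phi) (position_code (reduction phi)).
Proof.
move=> phi3.
have shows0 : shows (initial reduction_machine (cnf_code phi))
   (View (map cmd [:: DeclareX; DeclareY; Main]) (zip [::] (cnf_code phi)) (zip [::] [::]) [::]).
  split; rewrite /initial /= ?ffunE //=.
  - by rewrite /reduction_start /insub_bseq insubdK.
  - by rewrite -val_eqE /= inordK.
have [k le_k [/= stk _ _ out]] := reduction_reaches phi3 shows0.
(* A halted machine stays put, so the run can be prolonged to the exact number of steps required. *)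
have final_stays C j : final C.1 -> iter j step C = C.
  by move=> fC; elim: j => //= j ->; rewrite /Defs.step fC.
rewrite /outputs_within.
have fin : final (iter k step (initial reduction_machine (cnf_code phi))).1.
  by rewrite /= stk.
rewrite -(subnK le_k) iterD (final_stays _ _ fin); split=> //.
(* The head stands past the output, so the word is found reversed in the left part of the tape. *)
have [i [j ->]] := @eqt_cells _ _ [::] out.
exists i, j; rewrite /= rev_cat rev_nseq -catA; congr (_ ++ (_ ++ _)).
by rewrite /word_cells -map_rev revK.
Qed.

Theorem mainTheorem5 :
  exists f : cnf3 -> epmx,
    polytime_computable (fun phi : cnf3 => cnf_code (sval phi))
                        (fun p : epmx => position_code (sval p)) f /\
    (forall phi : cnf3,
       satisfiable (sval phi) <-> X_has_winning_strategy (sval (f phi))).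
Proof.
exists (fun phi => exist is_epmx _ (reduction_epmx (svalP phi))); split.
  by exists reduction_machine, 150, 2 => phi; exact: reduction_outputs (svalP phi).
by move=> phi; exact: reduction_correct (svalP phi).
Qed.
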